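(* Let $u_-<u_+$ be real constants. Suppose $\varphi_1,\varphi_2\in C^2(\mathbb R)$ both satisfy $1-\varphi_i'(x)>d_0>0$ for all $x\in\mathbb R$ ($i=1,2$), where $d_0$ is a positive constant. If $$\|\varphi_1(x)-\varphi_2(x)\|_{L^\infty(\mathbb R)}<+\infty,$$ then $$\|u_1^R(t,x,y)-u_2^R(t,x,y)\|_{L^\infty(\mathbb R^2)}\le\frac{C}{t},\qquad t>0,$$ where $u_i^R$ ($i=1,2$) is the rarefaction wave with initial discontinuity $y-\varphi_i(x)=0$ defined in the context, and $C$ is a positive constant depending only on $d_0$ and $\|\varphi_1-\varphi_2\|_{L^\infty(\mathbb R)}$.
   Context: For $i=1,2$, $Z_i(x,y)$ is the implicit function determined by $y-Z_i-\varphi_i(x-Z_i)=0$, and for $t>0$ $$u_i^R(t,x,y)=\begin{cases}u_-,& y<u_-t+\varphi_i(x-u_-t),\\ \dfrac{Z_i(x,y)}{t},& u_-t+\varphi_i(x-u_-t)\le y\le u_+t+\varphi_i(x-u_+t),\\ u_+,& y>u_+t+\varphi_i(x-u_+t).\end{cases}$$ This is the rarefaction wave solution of $u_t+uu_x+uu_y=0$ with initial data $u_-$ for $y-\varphi_i(x)<0$ and $u_+$ for $y-\varphi_i(x)>0$. *)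

(* Defs.v *)
From HB Require Import structures.
From mathcomp Require Import all_boot all_order all_algebra.
From mathcomp Require Import all_classical all_reals all_analysis.

Set Implicit Arguments.
Unset Strict Implicit.
Unset Printing Implicit Defensive.

Import Order.TTheory GRing.Theory Num.Theory.
Import numFieldNormedType.Exports.

Local Open Scope classical_set_scope.
Local Open Scope ring_scope.

Definition C2 (R : realType) (phi : R -> R) : Prop :=
  [/\ forall x, derivable phi x 1,
      forall x, derivable (phi^`()%classic) x 1 &
      continuous (phi^`(2)%classic)].

(* The solution z of y - z - phi (x - z) = 0. The default value 0 is only used
   when there is no solution; when 1 - phi' is bounded below by a positive
   constant, the solution exists and is unique for all x and y. *)
Definition implicitZ (R : realType) (phi : R -> R) (x y : R) : R :=
  xget 0 [set z | y - z - phi (x - z) = 0].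

Definition rarefaction (R : realType) (um up : R) (phi : R -> R)
    (t x y : R) : R :=
  if y < um * t + phi (x - um * t) then um
  else if y <= up * t + phi (x - up * t) then implicitZ phi x y / t
  else up.

Definition Linf_norm1 (R : realType) (f : R -> R) : \bar R :=
  Lnorm (@lebesgue_measure R) +oo%E (fun x => (f x)%:E).

Definition Linf_norm2 (R : realType) (f : R -> R -> R) : \bar R :=
  Lnorm (@lebesgue_measure R \x @lebesgue_measure R)%E +oo%E
    (fun p => (f p.1 p.2)%:E).

(* Main.v *)
Require Import Defs.
From mathcomp Require Import all_boot all_order all_algebra.
From mathcomp Require Import all_classical all_reals all_analysis.
From mathcomp Require Import measurable_realfun ess_sup_inf lra.
Import Order.TTheory GRing.Theory Num.Theory.
Import numFieldNormedType.Exports.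
Local Open Scope classical_set_scope.
Local Open Scope ring_scope.

(** Put [g_i z := y - z - phi_i (x - z)]; since [g_i' < - d0], [g_i] is strictly
    decreasing, and [w_i := t * u_i^R] is the projection onto [[um t, up t]] of
    its zero [Z_i]. Hence [0 <= g_i w_i] unless [w_i] is the left endpoint and
    [g_i w_i <= 0] unless it is the right one. If [w_1 < w_2], then
    [g_1 w_1 <= 0 <= g_2 w_2], so
    [d0 (w_2 - w_1) <= g_1 w_1 - g_1 w_2 <= g_2 w_2 - g_1 w_2
                     = phi_1 (x - w_2) - phi_2 (x - w_2)],
    which is at most the L^oo norm of [phi_1 - phi_2], by continuity. *)

(** If [|f x|] exceeded the essential supremum, continuity would make it do so on a whole ball
    around [x]; that ball has positive measure but lies in a null set. *)
Lemma Linf_norm1_ge (R : realType) (f : R -> R) (x : R) :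
  continuous f -> (`|f x|%:E <= Linf_norm1 f)%E.
Proof.
move=> cf; rewrite /Linf_norm1 unlock.
set mu := lebesgue_measure.
(* The norm at [+oo] is the essential supremum only for a nonzero measure, and 0 otherwise. *)
have -> : (0 < mu setT)%E.
  by rewrite -set_itvNyy /mu lebesgue_measure_itv/= addye// lt0y.
have [N [mN N0 sN]] := ess_sup_ge mu (abse \o (fun x => (f x)%:E)).
move: sN; set M := ess_sup _ _ => sN.
rewrite leNgt; apply/negP => Mx.
have : \forall z \near x, (M < `|f z|%:E)%E.
  case: M Mx {sN} => [m| |] //=; last by move=> _; near=> z; rewrite ltNyr.
  rewrite lte_fin => mx.
  have : `|f z| @[z --> x] --> `|f x| by apply: cvg_norm; exact: cf.
  by move=> /cvgr_gt/(_ _ mx); apply: filterS => z; rewrite lte_fin.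
case/nbhs_ballP => e /= e0 be.
have bN : ball x e `<=` N.
  by move=> z /be Mz; apply: sN => /=; apply/negP; rewrite -ltNge.
have : (mu (ball x e) <= mu N)%E.
  by apply: le_measure => //; rewrite inE //; exact: measurable_ball.
rewrite [leRHS]N0 /mu lebesgue_measure_ball ?(ltW e0)// lee_fin; lra.
Unshelve. all: by end_near. Qed.

Lemma Linf_norm2_le (R : realType) (f : R -> R -> R) (c : R) :
  0 <= c -> (forall x y, `|f x y| <= c) -> (Linf_norm2 f <= c%:E)%E.
Proof.
(* In the degenerate branch of the definition the norm is 0, and [0 <= c] suffices. *)
move=> c0 fc; rewrite /Linf_norm2 unlock; case: ifPn => _; last by rewrite lee_fin.
by apply/ess_supP; apply: nearW => -[x y] /=; rewrite lee_fin.
Qed.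

(** By the mean value theorem. Since [y - z - phi (x - z)] is [s - phi s] at [s = x - z], up to the
    constant [y - x], it decreases in [z] at rate at least [d0]. *)
Lemma sub_id_slope (R : realType) (phi : R -> R) (d0 a b : R) :
  (forall x, derivable phi x 1) -> (forall x, d0 < 1 - phi^`()%classic x) ->
  a <= b -> d0 * (b - a) <= (b - phi b) - (a - phi a).
Proof.
move=> dphi phid ab.
have [||c _ phiE] := @MVT_segment R phi (phi^`()%classic) a b ab.
- by move=> x _; rewrite derive1E; apply: derivableP.
- apply: derivable_within_continuous => x _; exact: dphi.
have := ler_wpM2r _ (ltW (phid c)).
move=> /(_ (b - a)); rewrite subr_ge0 => /(_ ab); rewrite mulrBl mul1r -phiE; lra.
Qed.

(** The sign conditions express the projection without naming the zero of [g], which treats the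
    three branches of the wave uniformly. *)
Lemma rarefaction_projection (R : realType) (um up d0 : R) (phi : R -> R)
    (t x y : R) (g := fun z => y - z - phi (x - z))
    (w := rarefaction um up phi t x y * t) :
  um <= up -> 0 < d0 -> 0 < t -> continuous phi ->
  (forall a b : R, a <= b -> d0 * (b - a) <= (b - phi b) - (a - phi a)) ->
  [/\ um * t <= w <= up * t, um * t < w -> 0 <= g w & w < up * t -> g w <= 0].
Proof.
move=> umup d0_gt0 t0 cphi slope.
have umupt : um * t <= up * t by rewrite ler_pM2r.
have gdecr a b : a < b -> g b < g a.
  move=> ab; have : x - b <= x - a by lra.
  move=> /slope; have : 0 < d0 * (b - a) by rewrite mulr_gt0 ?subr_gt0.
  rewrite (_ : x - a - (x - b) = b - a); last lra.
  rewrite /g; lra.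
rewrite /w /rarefaction; case: (ltP y (um * t + _)) => [ylt|yge].
  by rewrite lexx umupt ltxx; split => // _; rewrite /g; lra.
case: (leP y (up * t + _)) => [yle|ygt]; last first.
  by rewrite lexx umupt ltxx; split => // _; rewrite /g; lra.
rewrite divfK ?gt_eqF//.
have gm : 0 <= g (um * t) by rewrite /g; lra.
have gp : g (up * t) <= 0 by rewrite /g; lra.
have gZ : g (implicitZ phi x y) = 0.
  (* The default value of [xget] is excluded: in the middle branch [g] changes sign between the
     endpoints, so it has a root. *)
  rewrite /implicitZ; case: xgetP => [z _ //|noroot].
  have [||z _ gz] := @IVT R g (um * t) (up * t) 0 umupt.
  - apply: continuous_subspaceT => z; apply: cvgB.
      by apply: cvgB; [exact: cvg_cst|exact: cvg_id].
    apply: (@cvg_comp _ _ _ (fun z => x - z) phi _ (nbhs (x - z))); last exact: cphi.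
    by apply: cvgB; [exact: cvg_cst|exact: cvg_id].
  - by rewrite ge_min gp orbT le_max gm.
  by case: (noroot z).
split; rewrite ?gZ//; apply/andP; split; rewrite leNgt; apply/negP => /gdecr;
  rewrite gZ; lra.
Qed.

Lemma rarefaction_diff_le (R : realType) (um up d0 M : R) (phi1 phi2 : R -> R)
    (t x y : R) :
  um <= up -> 0 < d0 -> 0 <= M -> 0 < t -> continuous phi1 -> continuous phi2 ->
  (forall a b : R, a <= b -> d0 * (b - a) <= (b - phi1 b) - (a - phi1 a)) ->
  (forall a b : R, a <= b -> d0 * (b - a) <= (b - phi2 b) - (a - phi2 a)) ->
  (forall s, phi1 s - phi2 s <= M) ->
  rarefaction um up phi2 t x y - rarefaction um up phi1 t x y <= M / d0 / t.
Proof.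
move=> umup d0_gt0 M0 t0 c1 c2 s1 s2 M12.
have [] := rarefaction_projection _ _ _ _ _ t x y umup d0_gt0 t0 c1 s1.
have [] := rarefaction_projection _ _ _ _ _ t x y umup d0_gt0 t0 c2 s2.
set u1 := rarefaction _ _ phi1 _ _ _; set u2 := rarefaction _ _ phi2 _ _ _.
move=> /andP[_ w2p] g2 _ /andP[w1m _] _ g1.
case: (leP u2 u1) => u12.
  by apply: (@le_trans _ _ 0); rewrite ?subr_le0// !divr_ge0// ltW.
have w12 : u1 * t < u2 * t by rewrite ltr_pM2r.
rewrite !ler_pdivlMr// mulrC mulrBl.
(* As [w_1 < w_2], [w_2] is not the left endpoint and [w_1] is not the right one, so both sign
   conditions apply. *)
have /g2 {}g2 := le_lt_trans w1m w12.
have /g1 {}g1 := lt_le_trans w12 w2p.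
have /s1 : x - u2 * t <= x - u1 * t by lra.
rewrite (_ : x - u1 * t - (x - u2 * t) = u2 * t - u1 * t); last lra.
have := M12 (x - u2 * t); lra.
Qed.

Theorem proposition2p4 (R : realType) :
  exists C : R -> \bar R -> R,
    forall (um up d0 : R) (phi1 phi2 : R -> R),
      um < up ->
      C2 phi1 -> C2 phi2 ->
      0 < d0 ->
      (forall x, d0 < 1 - phi1^`()%classic x) ->
      (forall x, d0 < 1 - phi2^`()%classic x) ->
      (Linf_norm1 (fun x => (phi1 x - phi2 x)%R) < +oo)%E ->
      let c := C d0 (Linf_norm1 (fun x => phi1 x - phi2 x)) in
      0 < c /\
      forall t : R, 0 < t ->
        (Linf_norm2 (fun x y => (rarefaction um up phi1 t x y
                                 - rarefaction um up phi2 t x y)%R)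
         <= (c / t)%:E)%E.
Proof.
(* The [+ 1] keeps the constant positive when [phi1 = phi2]. *)
exists (fun d0 M => (fine M + 1) / d0) => um up d0 phi1 phi2 /ltW umup.
move=> [d1 _ _] [d2 _ _] d0_gt0 phi1d phi2d Moo /=.
have cont (phi : R -> R) : (forall x, derivable phi x 1) -> continuous phi.
  by move=> dphi x; apply/differentiable_continuous/derivable1_diffP/dphi.
have c1 := cont _ d1; have c2 := cont _ d2.
set M := Linf_norm1 _ in Moo *.
have M0 : (0 <= M)%E by exact: Lnorm_ge0.
have M12 s : `|phi1 s - phi2 s| <= fine M + 1.
  have : (`|phi1 s - phi2 s|%:E <= M)%E.
    by apply: (@Linf_norm1_ge R (fun x => phi1 x - phi2 x)) => z; apply: cvgB;
      [exact: c1|exact: c2].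
  rewrite -[M]fineK ?ge0_fin_numE// lee_fin; lra.
have Mp_gt0 : 0 < fine M + 1 by rewrite ltr_wpDl// fine_ge0.
have Mp := ltW Mp_gt0.
have C_gt0 := divr_gt0 Mp_gt0 d0_gt0.
split => // t t0.
have Ct_gt0 := divr_gt0 C_gt0 t0.
apply: Linf_norm2_le; first exact: ltW.
move=> x y.
have s1 a b := @sub_id_slope R phi1 d0 a b d1 phi1d.
have s2 a b := @sub_id_slope R phi2 d0 a b d2 phi2d.
have le12 s : phi1 s - phi2 s <= fine M + 1 by have := M12 s; rewrite ler_norml; lra.
have le21 s : phi2 s - phi1 s <= fine M + 1 by have := M12 s; rewrite ler_norml; lra.
(* The estimate is one-sided; exchanging the two waves bounds the absolute value. *)
have := rarefaction_diff_le _ _ _ _ _ _ _ t x y umup d0_gt0 Mp t0 c1 c2 s1 s2 le12.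
have := rarefaction_diff_le _ _ _ _ _ _ _ t x y umup d0_gt0 Mp t0 c2 c1 s2 s1 le21.
by rewrite ler_norml; lra.
Qed.
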